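(* Let $k\ge1$. For $1\le s\le k$ and $m\ge j\ge1$, \[ GF_k(k(m-1)+s,j)=z^{j-1}q^{k\binom{j}{2}+sj+k(m-j)}{m-1\brack j-1}_k, \] and for $m\ge j\ge1$, \[ GF_k(km,\overline j)=z^jq^{k\binom{j}{2}+km}{m-1\brack j-1}_k. \]
   Context: Overpartitions here are non-increasing sequences of positive integers in which the first occurrence of each distinct part value may be overlined (among equal sizes the overlined part comes first); a part $t$ or $\overline t$ has size $t$, written $|\cdot|=t$; $|\lambda|$ is the sum of part sizes and $\ell_o(\lambda)$ the number of overlined parts. An $F_k$-overpartition is such an overpartition $\pi=(\pi_1,\ldots,\pi_\ell)$ with the property that whenever $\pi_i$ is overlined, $\ell-i\equiv-1\pmod k$. For $m\ge1$, $\mathcal{BF}_k(m)$ is the set of $F_k$-overpartitions $\lambda=(\lambda_1,\ldots,\lambda_m)$ with exactly $m$ parts such that (i) if $k=1$ then $\lambda_m=\overline1$ or $1$, and if $k\ge2$ then $\lambda_m=1$; (ii) for $1\le i<m$, $|\lambda_i|\le|\lambda_{i+1}|+1$, with strict inequality if $\lambda_{i+1}$ is non-overlined. For $m,j\ge1$, $\mathcal{BF}_k(m,j)$ (resp. $\mathcal{BF}_k(m,\overline j)$) is the set of overpartitions in $\mathcal{BF}_k(m)$ whose largest part is $j$ (resp. $\overline j$), and $GF_k(m,j)=\sum_{\lambda\in\mathcal{BF}_k(m,j)}z^{\ell_o(\lambda)}q^{|\lambda|}$, $GF_k(m,\overline j)=\sum_{\lambda\in\mathcal{BF}_k(m,\overline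 j)}z^{\ell_o(\lambda)}q^{|\lambda|}$. Also ${A\brack B}_k=\frac{(q^k;q^k)_A}{(q^k;q^k)_B(q^k;q^k)_{A-B}}$ for $A\ge B\ge0$ and $0$ otherwise, with $(a;q)_n=\prod_{i=0}^{n-1}(1-aq^i)$. *)

(* Defs.v *)
From mathcomp Require Import all_boot all_order all_algebra.
From mathcomp Require Import boolp classical_sets functions cardinality fsbigop.

Set Implicit Arguments.
Unset Strict Implicit.
Unset Printing Implicit Defensive.

Import GRing.Theory.

Local Open Scope ring_scope.
Local Open Scope classical_set_scope.

(* [(t, false)] is the part t, [(t, true)] is the overlined part t. *)
Definition opart : Type := (nat * bool)%type.

Definition psize (x : opart) : nat := x.1.
Definition overlined (x : opart) : bool := x.2.

(* Positions are counted from 0: [part p i] is the part of index i + 1. *)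
Definition part (p : seq opart) (i : nat) : opart := nth (0%N, false) p i.

Definition weight (p : seq opart) : nat := (\sum_(x <- p) psize x)%N.
Definition num_overlined (p : seq opart) : nat := count overlined p.

Definition is_overpartition (p : seq opart) : Prop :=
  [/\ forall x, x \in p -> (0 < psize x)%N,
      forall i, (i.+1 < size p)%N ->
        (psize (part p i.+1) <= psize (part p i))%N
    & forall i i', (i < i' < size p)%N -> overlined (part p i') ->
        psize (part p i) <> psize (part p i')].

Definition is_Fk_overpartition (k : nat) (p : seq opart) : Prop :=
  is_overpartition p /\
  forall i, (i < size p)%N -> overlined (part p i) ->
    ((size p)%:Z - i.+1%:Z = -1 %[mod k%:Z])%Z.

Definition BF (k m : nat) : set (seq opart) :=
  [set p | [/\ is_Fk_overpartition k p,
    size p = m,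
    (if k == 1%N then psize (part p m.-1) = 1%N
     else part p m.-1 = (1%N, false))
  & forall i, (i.+1 < m)%N ->
      if overlined (part p i.+1)
      then (psize (part p i) <= psize (part p i.+1) + 1)%N
      else (psize (part p i) < psize (part p i.+1) + 1)%N]].

(* Among parts of equal size the overlined one comes first, so the largest
   part is the first one, including its overline. *)
Definition BF_largest (k m : nat) (x : opart) : set (seq opart) :=
  [set p | BF k m p /\ part p 0 = x].

(* The field Q(z, q) of rational functions in the indeterminates z and q,
   as fractions of polynomials in q with coefficients in Z[z]. *)
Definition ratfun : fieldType := {fraction {poly {poly int}}}.
Definition zvar : ratfun := tofrac ('X%:P : {poly {poly int}}).
Definition qvar : ratfun := tofrac ('X : {poly {poly int}}).

(* [\sum_(p \in A) _] is 0 when infinitely many terms are nonzero; this does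
   not occur here, see [finite_BF_largest]. *)
Definition GF (k m : nat) (x : opart) : ratfun :=
  \sum_(p \in BF_largest k m x) (zvar ^+ num_overlined p * qvar ^+ weight p).

Definition qpoch (a b : ratfun) (n : nat) : ratfun :=
  \prod_(i < n) (1 - a * b ^+ i).

Definition qbinom (k A B : nat) : ratfun :=
  if (B <= A)%N then
    qpoch (qvar ^+ k) (qvar ^+ k) A
      / (qpoch (qvar ^+ k) (qvar ^+ k) B * qpoch (qvar ^+ k) (qvar ^+ k) (A - B))
  else 0.

Lemma finite_BF_largest (k m : nat) (x : opart) :
  (0 < m)%N -> finite_set (BF_largest k m x).
Proof.
move=> m_gt0.
pose f (t : m.-tuple ('I_m.+1 * bool)) : seq opart :=
  [seq (nat_of_ord y.1, y.2) | y <- t].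
apply: (@sub_finite_set _ _ (range f)); last exact: finite_image.
move=> p [[_ sz_p last_p step_p] _].
have last1 : psize (part p m.-1) = 1%N.
  by move: last_p; case: ifP => // _ ->.
have bound d : (d < m)%N -> (psize (part p (m.-1 - d)) <= d.+1)%N.
  elim: d => [|d IHd] lt_dm; first by rewrite subn0 last1.
  have lt_dm1 : (d < m.-1)%N by rewrite -ltnS prednK.
  have Ed : (m.-1 - d.+1).+1 = (m.-1 - d)%N by rewrite subnSK.
  have lt_m : ((m.-1 - d.+1).+1 < m)%N.
    by rewrite Ed -[X in (_ < X)%N](prednK m_gt0) ltnS leq_subr.
  have := step_p _ lt_m; rewrite Ed => le_step.
  have {}le_step : (psize (part p (m.-1 - d.+1)) <= psize (part p (m.-1 - d)) + 1)%N.
    by move: le_step; case: ifP => // _ /ltnW.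
  by apply: leq_trans le_step _; rewrite addn1 ltnS IHd // ltnW.
have le_m i : (i < m)%N -> (psize (part p i) < m.+1)%N.
  move=> lt_im; have le_im : (i <= m.-1)%N by rewrite -ltnS prednK.
  have := bound (m.-1 - i)%N; rewrite subKn // ltnS => bi.
  apply: leq_trans (bi _) _; first by rewrite -[X in (_ < X)%N](prednK m_gt0) ltnS leq_subr.
  by rewrite -[X in (_ <= X)%N](prednK m_gt0) ltnS leq_subr.
exists [tuple (inord (psize (part p i)), overlined (part p i)) | i < m] => //.
apply: (@eq_from_nth _ (0%N, false)); first by rewrite size_map size_tuple.
move=> i; rewrite size_map size_tuple => lt_im.
rewrite (nth_map (ord0, false)) ?size_tuple //.
rewrite -[i]/(nat_of_ord (Ordinal lt_im)) -tnth_nth tnth_mktuple /= inordK ?le_m //.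
by rewrite /part; case: (nth _ _ _).
Qed.

(* Main.v *)
(* Removing the first part of an element of BF_k(m+1) leaves an element of
   BF_k(m), and the size of the removed part is forced: it equals the next size,
   plus one when the next part is overlined. An overline is allowed exactly when
   the number of parts from that position on is a multiple of k. Hence the
   generating functions satisfy
     GF(m+1, j) = q^j (GF(m, j) + GF(m, j-1 overlined)),
     GF(m, j overlined) = z GF(m, j) if k divides m, and 0 otherwise,
   and passing from m = k n to m = k n + 1 is the q-Pascal rule. *)
Require Import Defs.
From mathcomp Require Import all_boot all_order all_algebra.
From mathcomp Require Import boolp classical_sets functions cardinality fsbigop.
From mathcomp Require Import zify ring.

Set Implicit Arguments.
Unset Strict Implicit.
Unset Printing Implicit Defensive.

Import GRing.Theory.

Local Open Scope ring_scope.

(** * Removing the first part of an element of [BF] *)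

Lemma Fk_congruenceE (k n i : nat) : (i < n)%N ->
  ((n%:Z - i.+1%:Z = -1 %[mod k%:Z])%Z <-> (k %| n - i)%N).
Proof.
move=> lt_in; rewrite (rwP eqP) eqz_mod_dvd.
(* Index [i] is position [i.+1], so [n - i] counts the parts from there to the end, a number that
   prepending parts does not change. *)
suff -> : n%:Z - i.+1%:Z - -1 = (n - i)%N%:Z by [].
by lia.
Qed.

Lemma overpartition_first_max (p : seq opart) (i : nat) :
  is_overpartition p -> (i < size p)%N ->
  (psize (part p i) <= psize (part p 0))%N.
Proof.
move=> [_ dec _]; elim: i => [//|i IHi] lt_ip.
exact: leq_trans (dec _ lt_ip) (IHi (ltnW lt_ip)).
Qed.

Lemma overpartition_first_gt0 (p : seq opart) :
  is_overpartition p -> (0 < size p)%N -> (0 < psize (part p 0))%N.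
Proof. by move=> [pos _ _] p_gt0; apply/pos/mem_nth. Qed.

(** Let t be the size of the next part. If it is not overlined, t <= [psize x] < t + 1. If it is
    overlined, t <= [psize x] <= t + 1 and equality with t is excluded, since only a first
    occurrence carries an overline. *)
Lemma BF_cons (k m : nat) (x : opart) (p : seq opart) : (0 < m)%N ->
  BF k m.+1 (x :: p) <->
  [/\ BF k m p, (overlined x -> k %| m.+1)%N
    & psize x = (psize (part p 0) + overlined (part p 0))%N].
Proof.
case: m => // m _; split.
- move=> [[[pos dec inj] Fk] [sz_p] last_p step].
  have Fk' i : (i < m.+2)%N -> overlined (part (x :: p) i) -> (k %| m.+2 - i)%N.
    move=> lt_i ov; apply/Fk_congruenceE => //.
    by have := Fk i; rewrite /= sz_p; apply.
  split.
  + split=> //.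
    * split; first split.
      - by move=> y yp; apply: pos; rewrite inE yp orbT.
      - by move=> i lt_i; apply: (dec i.+1).
      - by move=> i i' lt_i; apply: (inj i.+1 i'.+1).
      - move=> i; rewrite sz_p => lt_i ov; apply/Fk_congruenceE => //.
        by rewrite -subSS; apply: Fk'.
    * by move=> i lt_i; apply: (step i.+1).
  + exact: (Fk' 0%N).
  + have {}step : if overlined (part p 0) then (psize x <= psize (part p 0) + 1)%N
        else (psize x < psize (part p 0) + 1)%N := step 0%N isT.
    have {}dec : (psize (part p 0) <= psize x)%N by apply: (dec 0%N); rewrite /= sz_p.
    have {}inj : overlined (part p 0) -> psize x <> psize (part p 0).
      by apply: (inj 0%N 1%N); rewrite /= sz_p.
    case: (overlined (part p 0)) step inj => [le_x /(_ isT)|lt_x _]; lia.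
- move=> [[[op Fk] sz_p last_p step] ovx sz_x].
  have p_gt0 : (0 < size p)%N by rewrite sz_p.
  have y_gt0 := overpartition_first_gt0 op p_gt0.
  have fmax i := @overpartition_first_max p i op.
  case: op => pos dec inj.
  split=> //; last 2 first.
  + by rewrite /= sz_p.
  + case=> [_|i]; last exact: step.
    change (if overlined (part p 0) then psize x <= psize (part p 0) + 1
            else psize x < psize (part p 0) + 1)%N.
    by case: ifP sz_x => _; lia.
  split; first split.
  + by move=> y; rewrite inE => /orP[/eqP->|/pos//]; lia.
  + case=> [_|i]; last exact: dec.
    change (psize (part p 0) <= psize x)%N; lia.
  + move=> [|i] [|i'] // lt_i ov; last exact: inj.
    change (overlined (part p i') : Prop) in ov.
    change (psize x <> psize (part p i')).
    case: i' ov lt_i => [|i'] ov lt_i; first by rewrite sz_x ov; lia.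
    (* A later overlined part is strictly smaller than the head of [p], hence smaller than [x]. *)
    have := inj 0%N i'.+1 lt_i ov; have := fmax i'.+1 lt_i; lia.
  + move=> [|i] lt_i ov; apply/Fk_congruenceE => //=.
      by rewrite sz_p subn0 ovx.
    by rewrite subSS; apply/(Fk_congruenceE k lt_i)/Fk.
Qed.

Lemma BF_1 (k : nat) (p : seq opart) : (0 < k)%N ->
  BF k 1 p <-> exists2 c : bool, p = [:: (1%N, c)] & (c -> k = 1%N).
Proof.
move=> k_gt0; split.
- move=> [_]; case: p => [//|[t c] [|//]] _ /=; rewrite /part /=.
  by case: eqP => [-> ->|_ [-> ->]] _; [exists c | exists false].
- move=> [c -> c1]; split=> //.
  + split; first split => //.
    * by move=> x; rewrite inE => /eqP->.
    * by move=> [|i] [|i'] /andP[].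
    * by case=> [|i] // _ /c1->; apply/Fk_congruenceE.
  + by rewrite /part /=; case: eqP => // k1; case: c c1 => // /(_ isT).
Qed.

Lemma BF_largest_cons (k m j : nat) (c : bool) : (0 < m)%N ->
  (c -> k %| m.+1)%N ->
  (BF_largest k m.+1 (j.+1, c) =
   cons (j.+1, c) @` (BF_largest k m (j.+1, false) `|` BF_largest k m (j, true)))%classic.
Proof.
move=> m_gt0 ck; apply/seteqP; split=> p.
- case: p => [|x p] [BFp hd_p]; first by case: BFp => _ /esym; case: (m) m_gt0.
  rewrite -[x]/(part (x :: p) 0) hd_p in BFp *.
  have [BFp' _ sz_x] := (BF_cons k (j.+1, c) p m_gt0).1 BFp.
  exists p => //; have {}sz_x : j.+1 = ((part p 0).1 + (part p 0).2)%N := sz_x.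
  case Ep: (part p 0) sz_x => [t []] /= Ej; [right|left]; split=> //;
    by rewrite Ep; congr pair; lia.
- move=> [p' + <-]; case=> -[BFp hd_p]; split=> //; apply/BF_cons => //;
    split=> //; by rewrite hd_p /psize /=; lia.
Qed.

Lemma BF_largest_zero (k m : nat) (c : bool) : (0 < m)%N ->
  BF_largest k m (0%N, c) = set0.
Proof.
move=> m_gt0; rewrite -subset0 => p [[[op _] sz_p _ _] hd_p].
have := overpartition_first_gt0 op; rewrite sz_p hd_p.
by move=> /(_ m_gt0).
Qed.

Lemma BF_largest_overlined0 (k m j : nat) : (0 < m)%N -> ~~ (k %| m)%N ->
  BF_largest k m (j, true) = set0.
Proof.
move=> m_gt0 ndvd; rewrite -subset0 => p [[[_ Fk] sz_p _ _] hd_p].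
move: Fk => /(_ 0%N); rewrite sz_p hd_p => /(_ m_gt0 isT).
by move=> /(Fk_congruenceE k m_gt0); rewrite subn0 (negbTE ndvd).
Qed.

Lemma BF_largest_1 (k j : nat) (c : bool) : (0 < k)%N ->
  BF_largest k 1 (j, c) =
  if (j == 1%N) && (c ==> (k == 1%N)) then [set [:: (1%N, c)]]%classic else set0.
Proof.
move=> k_gt0; apply/seteqP; split=> p.
- move=> [/(BF_1 p k_gt0)[c' -> c1]] [<- <-] /=.
  by case: c' c1 => //= /(_ isT) ->.
- case: ifP => // /andP[/eqP-> /implyP c1] /= ->; split=> //.
  by apply/BF_1 => //; exists c => // /c1/eqP.
Qed.

(** * Recurrences for the generating functions *)

Lemma GF_set0 (k m : nat) (x : opart) : BF_largest k m x = set0 -> GF k m x = 0.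
Proof. by rewrite /GF => ->; rewrite fsbig_set0. Qed.

Lemma GF_cons (k m j : nat) (c : bool) : (0 < m)%N -> (c -> k %| m.+1)%N ->
  GF k m.+1 (j.+1, c) =
  zvar ^+ c * qvar ^+ j.+1 * (GF k m (j.+1, false) + GF k m (j, true)).
Proof.
move=> m_gt0 ck; rewrite /GF BF_largest_cons //.
rewrite fsbig_image; last by move=> p p' _ _ [].
rewrite -fsbigU0; first last.
(* The two sets are disjoint: their first parts differ in the overline. *)
- by move=> p [[_ hd_p] [_ hd_p']]; have := etrans (esym hd_p) hd_p'.
- exact: finite_BF_largest.
- exact: finite_BF_largest.
rewrite mulr_fsumr; apply: eq_fsbigr => p _.
rewrite /num_overlined /weight big_cons /= !exprD /psize /=; ring.
Qed.

Lemma GF_1 (k j : nat) (c : bool) : (0 < k)%N ->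
  GF k 1 (j, c) =
  if (j == 1%N) && (c ==> (k == 1%N)) then zvar ^+ c * qvar else 0.
Proof.
move=> k_gt0; rewrite /GF BF_largest_1 //; case: ifP => _.
  by rewrite fsbig_set1 /num_overlined /weight big_seq1 /= addn0.
by rewrite fsbig_set0.
Qed.

(** The admissible tails do not depend on whether the first part is overlined, so the overline only
    contributes a factor z. For [m] = 1 the divisibility forces [k] = 1, where both base values
    exist. *)
Lemma GF_overlined (k m j : nat) : (0 < k)%N -> (0 < m)%N -> (k %| m)%N ->
  GF k m (j, true) = zvar * GF k m (j, false).
Proof.
case: j => [|j] k_gt0 m_gt0 km.
  by rewrite !GF_set0 ?mulr0 ?BF_largest_zero.
case: m m_gt0 km => [//|[|m]] _ km; last first.
  by rewrite (@GF_cons k m.+1 j true) // (@GF_cons k m.+1 j false) // expr0 expr1 mul1r mulrA.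
rewrite !GF_1 // -(dvdn1 k) km andbT expr1 expr0 mul1r.
by case: ifP; rewrite ?mulr0.
Qed.

(** * Gaussian binomials and the q-Pascal rule *)

Lemma one_sub_qvar_neq0 (n : nat) : (0 < n)%N -> 1 - qvar ^+ n != 0.
Proof.
move=> n_gt0; rewrite -tofracXn -tofrac1 -tofracB tofrac_eq0.
by rewrite -oppr_eq0 opprB -size_poly_eq0 size_XnsubC.
Qed.

Lemma qpochS (a b : ratfun) (n : nat) :
  qpoch a b n.+1 = qpoch a b n * (1 - a * b ^+ n).
Proof. by rewrite /qpoch big_ord_recr. Qed.

Lemma qpoch_neq0 (k n : nat) : (0 < k)%N ->
  qpoch (qvar ^+ k) (qvar ^+ k) n != 0.
Proof.
move=> k_gt0; apply/prodf_neq0 => i _.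
by rewrite -exprS -exprM one_sub_qvar_neq0 // muln_gt0 k_gt0.
Qed.

Lemma qbinom0 (k m : nat) : (0 < k)%N -> qbinom k m 0 = 1.
Proof.
move=> k_gt0; rewrite /qbinom leq0n subn0 /(qpoch _ _ 0) big_ord0 mul1r divff //.
exact: qpoch_neq0.
Qed.

Lemma qbinomn (k m : nat) : (0 < k)%N -> qbinom k m m = 1.
Proof.
move=> k_gt0; rewrite /qbinom leqnn subnn /(qpoch _ _ 0) big_ord0 mulr1 divff //.
exact: qpoch_neq0.
Qed.

Lemma qbinom_small (k m j : nat) : (m < j)%N -> qbinom k m j = 0.
Proof. by move=> lt_mj; rewrite /qbinom leqNgt lt_mj. Qed.

(** Over a common denominator this is 1 - uv = u(1 - v) + (1 - u). It is used with u = q^(k(j+1))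
    and v = q^(k(d+1)), where m = j + d + 1. *)
Lemma pascal_fraction (F : fieldType) (Pm Pj Pd u v : F) :
  Pj != 0 -> Pd != 0 -> 1 - u != 0 -> 1 - v != 0 ->
  Pm * (1 - u * v) / (Pj * (1 - u) * (Pd * (1 - v))) =
  u * (Pm / (Pj * (1 - u) * Pd)) + Pm / (Pj * (Pd * (1 - v))).
Proof. by move=> Pj0 Pd0 u1 v1; field; rewrite Pj0 Pd0 u1 v1. Qed.

Lemma qbinomS (k m j : nat) : (0 < k)%N ->
  qbinom k m.+1 j.+1 = qvar ^+ (k * j.+1) * qbinom k m j.+1 + qbinom k m j.
Proof.
move=> k_gt0; case: (ltngtP m j) => [lt_mj|lt_jm|->]; last first.
- by rewrite !qbinomn // qbinom_small // mulr0 add0r.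
- have [d ->] : exists d, m = (j + d).+1 by exists (m - j.+1)%N; lia.
  have neq0 := qpoch_neq0 _ k_gt0.
  rewrite /qbinom !ifT; [|lia..].
  have -> : ((j + d).+2 - j.+1 = d.+1)%N by lia.
  have -> : ((j + d).+1 - j.+1 = d)%N by lia.
  have -> : ((j + d).+1 - j = d.+1)%N by lia.
  rewrite (qpochS _ _ (j + d).+1) (qpochS _ _ j) (qpochS _ _ d) -!exprS -!exprM.
  have -> : (k * (j + d).+2 = k * j.+1 + k * d.+1)%N by lia.
  by rewrite exprD pascal_fraction ?neq0 ?one_sub_qvar_neq0 ?muln_gt0 ?k_gt0.
- by rewrite !qbinom_small ?mulr0 ?addr0 //; lia.
Qed.

(** * Closed forms *)

Lemma GF_between_multiples (k m s j : nat) : (s < k)%N ->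
  GF k (k * m + s.+1) (j.+1, false) =
  qvar ^+ (s * j.+1) * GF k (k * m + 1) (j.+1, false).
Proof.
elim: s => [|s IHs] lt_sk; first by rewrite mul0n expr0 mul1r.
(* The tail has length [k * m + s.+1] with 0 < [s.+1] < [k], not a multiple of [k], so its head
   carries no overline and the new part repeats its size. *)
rewrite (addnS _ s.+1) GF_cons ?(addnS _ s) // -(addnS _ s).
rewrite (GF_set0 (BF_largest_overlined0 _ _ _)).
- by rewrite addr0 IHs ?(ltnW lt_sk) // expr0 mul1r mulrA -exprD mulSn.
- by rewrite addnS.
- by rewrite dvdn_addr ?dvdn_mulr // gtnNdvd.
Qed.

(** Induction on [m], one block of [k] parts at a time: the tail of length [k * m.+1] starts either
    with the same size or with an overlined part one smaller. Both cases reduce to length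
    [k * m + 1], and they give the two terms of the q-Pascal rule. *)
Lemma GF_after_multiple (k m j : nat) : (0 < k)%N ->
  GF k (k * m + 1) (j.+1, false) =
  zvar ^+ j * qvar ^+ (k * 'C(j.+1, 2) + j.+1 + k * (m - j)) * qbinom k m j.
Proof.
case: k => // k _; elim: m j => [|m IHm] j.
  rewrite muln0 add0n GF_1 // andbT eqSS.
  case: j => [|j]; last by rewrite qbinom_small ?mulr0.
  by rewrite qbinom0 // bin_small // !muln0 !expr0 !mul1r mulr1.
have km : (0 < k.+1 * m.+1)%N by [].
rewrite addn1 GF_cons // GF_overlined ?dvdn_mulr //.
rewrite [(k.+1 * m.+1)%N]mulnS [(k.+1 + _)%N]addnC.
rewrite !(GF_between_multiples m _ (ltnSn k)) IHm.
case: j => [|j].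
  rewrite (GF_set0 (BF_largest_zero _ _ _)) ?addn_gt0 ?orbT //.
  rewrite !qbinom0 // !bin_small // !mulr0 addr0 !mulr1 !expr0 !mul1r -!exprD.
  by congr (_ ^+ _); lia.
rewrite (GF_between_multiples m j (ltnSn k)) IHm.
set A := qbinom k.+1 m j.+1; set B := qbinom k.+1 m j.
rewrite qbinomS // -/A -/B expr0 mul1r subSS.
have bin2S i : 'C(i.+1, 2) = ('C(i, 2) + i)%N by rewrite binS bin1.
have -> : qvar ^+ (k.+1 * 'C(j.+2, 2) + j.+2 + k.+1 * (m - j)) =
          qvar ^+ j.+2 * (qvar ^+ (k * j.+1) *
            qvar ^+ (k.+1 * 'C(j.+1, 2) + j.+1 + k.+1 * (m - j))).
  by rewrite -!exprD bin2S; congr (_ ^+ _); lia.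
(* The exponents agree only for [j] < [m], because [m - j.+1] is truncated; otherwise [A]
   vanishes. *)
have A_eq : qvar ^+ (k * j.+2) *
              qvar ^+ (k.+1 * 'C(j.+2, 2) + j.+2 + k.+1 * (m - j.+1)) * A =
            qvar ^+ (k * j.+1) *
              qvar ^+ (k.+1 * 'C(j.+1, 2) + j.+1 + k.+1 * (m - j)) *
              qvar ^+ (k.+1 * j.+1) * A.
  case: (ltnP m j.+1) => [lt_mj|lt_jm]; first by rewrite /A qbinom_small // !mulr0.
  by rewrite -!exprD bin2S -(subnSK lt_jm); congr (_ ^+ _ * _); lia.
rewrite [zvar ^+ j.+1]exprS.
transitivity (zvar * zvar ^+ j * qvar ^+ j.+2 *
  (qvar ^+ (k * j.+2) *
     qvar ^+ (k.+1 * 'C(j.+2, 2) + j.+2 + k.+1 * (m - j.+1)) * A +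
   qvar ^+ (k * j.+1) *
     qvar ^+ (k.+1 * 'C(j.+1, 2) + j.+1 + k.+1 * (m - j)) * B)).
  by ring.
by rewrite A_eq; ring.
Qed.

Lemma GF_nonoverlined (k m s j : nat) : (0 < s <= k)%N ->
  GF k (k * m + s) (j.+1, false) =
  zvar ^+ j * qvar ^+ (k * 'C(j.+1, 2) + s * j.+1 + k * (m - j)) * qbinom k m j.
Proof.
case: s => [//|s] /andP[_ lt_sk].
rewrite GF_between_multiples // GF_after_multiple; last by case: k lt_sk.
rewrite mulrA [_ * (zvar ^+ j * _)]mulrCA -exprD.
by congr (_ * _ ^+ _ * _); lia.
Qed.

Theorem theorem3p12 (k : nat) (hk : (1 <= k)%N) :
  (forall s m j : nat, (1 <= s <= k)%N -> (1 <= j <= m)%N ->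
     GF k (k * (m - 1) + s) (j, false) =
       zvar ^+ (j - 1) * qvar ^+ (k * 'C(j, 2) + s * j + k * (m - j))
         * qbinom k (m - 1) (j - 1))
  /\
  (forall m j : nat, (1 <= j <= m)%N ->
     GF k (k * m) (j, true) =
       zvar ^+ j * qvar ^+ (k * 'C(j, 2) + k * m)
         * qbinom k (m - 1) (j - 1)).
Proof.
split=> [s m j s_range | m j] /andP[].
  case: j => // j _; case: m => // m _.
  by rewrite !subSS !subn0; exact: GF_nonoverlined.
case: j => // j _; case: m => // m lt_jm.
(* Writing the length as [k * m + k] makes this the case s = k, where k(j+1) + k(m-j) = k(m+1). *)
rewrite GF_overlined ?dvdn_mulr ?muln_gt0 ?hk // !subSS !subn0 mulnSr.
rewrite GF_nonoverlined ?hk ?leqnn // exprS !mulrA.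
have -> // : (k * 'C(j.+1, 2) + k * j.+1 + k * (m - j) =
              k * 'C(j.+1, 2) + (k * m + k))%N.
by rewrite -addnA -mulnDr -mulnSr; congr (_ + k * _)%N; lia.
Qed.
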